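(* Let $K$ be an algebraic number field with ring of integers $O_K$, let $\lambda\in O_K$, $\lambda\neq 0$, be an element with $K=\mathbb{Q}(\lambda)$, and put $O:=\mathbb{Z}[\lambda]$ (an order of $K$) and $O_{(M)}:=\mathbb{Z}[1/\lambda]$, which is the localization of $O$ at the multiplicatively closed set $M=\{1,\lambda,\lambda^2,\ldots\}$. Let $\mathfrak{A}$ and $\mathfrak{B}$ be ideals of $O_{(M)}$, and let $A$ and $B$ be ideals of $O$ such that $\mathfrak{A}=O_{(M)}\cdot A$ and $\mathfrak{B}=O_{(M)}\cdot B$. Then the following hold. (i) $\mathfrak{A}\sim\mathfrak{B}$ if and only if there are elements $x\in(A:B)$ and $y\in(B:A)$ such that $xy=\lambda^k$ for some non-negative integer $k$. (ii) Suppose that $A$ and $B$ are nonzero and that the ideals $A$, $B$, and $O\cdot\lambda$ are all prime to the conductor of $O$. Let $\{P_i\}_{i\in I}$ be the set of prime divisors in $O$ of the ideal $O\cdot\lambda$. Then $\mathfrak{A}\sim\mathfrak{B}$ if and only if $$[A]\equiv[B]\mod{\langle [P_i]\mid i\in I\rangle}$$ in $\mathrm{Pic}(O)$. (iii) Suppose that $A$ and $B$ are nonzero (with no assumption relating to the conductor of $O$). Let $\{Q_j\}_{j\in J}$ denote the set of prime divisors in $O_K$ of the ideal $O_K\cdot\lambda$. If $\mathfrak{A}\sim\mathfrak{B}$, then $$[O_K\cdot A]\equiv[O_K\cdot B]\mod{\langle [Q_j]\mid j\in J\rangle}$$ in $\mathrm{Cl}(O_K)$.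
   Context: For ideals $C,D$ of any one of the rings $O$, $O_K$, $O_{(M)}$ (all subrings of $K$), $C\sim D$ means that there exists $\xi\in K^\times$ with $\xi C=D$. For ideals $C,D$ of $O$, $(C:D):=\{\xi\in K\mid \xi D\subseteq C\}$. Since $\lambda$ is an algebraic integer, $\lambda\in\mathbb{Z}[1/\lambda]$, so $O\subseteq\mathbb{Z}[1/\lambda]$ and $\mathbb{Z}[1/\lambda]$ is the localization of $O$ at $M$; every ideal of $O_{(M)}$ is of the form $O_{(M)}\cdot A$ for some ideal $A$ of $O$. The conductor of $O$ is the ideal $\{a\in O_K\mid aO_K\subseteq O\}$ of $O$. An ideal $C$ of $O$ is prime to the conductor $\mathfrak{f}$ if $C+\mathfrak{f}=O$; nonzero ideals of $O$ prime to the conductor are invertible and factor uniquely into products of prime ideals of $O$. The prime divisors of an ideal are the prime ideals occurring in its prime factorization. $\mathrm{Pic}(O)$ is the Picard group of $O$, i.e. the group of invertible fractional ideals of $O$ modulo principal ones, and $[C]$ denotes the class in $\mathrm{Pic}(O)$ of an invertible ideal $C$ of $O$. $\mathrm{Cl}(O_K)$ is the ideal class group of $O_K$, and for a nonzero ideal $C$ of $O_K$, $[C]$ denotes its class in $\mathrm{Cl}(O_K)$. Both groups are written additively, $\langle\cdots\rangle$ denotes the subgroup generated by the listed classes (the trivial subgroup if the list is empty), and $a\equiv b \mod{H}$ means that $a-b\in H$. *)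

(* Defs.v *)
From HB Require Import structures.
From mathcomp Require Import all_boot all_order all_algebra all_field.
From mathcomp Require Import boolp classical_sets.

Set Implicit Arguments.
Unset Strict Implicit.
Unset Printing Implicit Defensive.
Import GRing.Theory.
Local Open Scope ring_scope.
Local Open Scope classical_set_scope.
Local Open Scope quotient_scope.

(* Every ring below is a subring R of an ambient field K (a predicate closed
   under the ring operations), and its ideals are subsets of K. *)

Section Ideals.
Variable K : fieldType.
Implicit Types (I J L C D : set K) (R : {pred K}).

Definition submodule R I :=
  [/\ I 0, forall a b, I a -> I b -> I (a + b)
    & forall r a, r \in R -> I a -> I (r * a)].

(* The zero ideal and the whole ring are allowed. *)
Definition is_ideal R I := I `<=` [set` R] /\ submodule R I.

Definition prime_ideal R I :=
  [/\ is_ideal R I, ~ I 1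
    & forall a b, a \in R -> b \in R -> I (a * b) -> I a \/ I b].

(* Finite sums of products; also used with I a ring, for the extension of an
   ideal to an overring. *)
Definition mul_ideal I J : set K :=
  [set x | exists2 s : seq (K * K),
     forall p, p \in s -> I p.1 /\ J p.2 & x = \sum_(p <- s) p.1 * p.2].

Definition add_ideal I J : set K :=
  [set x | exists a b, [/\ I a, J b & x = a + b]].

Definition scale_ideal (xi : K) C : set K := [set xi * c | c in C].

Definition prin_ideal R (x : K) : set K := [set r * x | r in [set` R]].

Definition ideal_sim C D := exists2 xi : K, xi != 0 & scale_ideal xi C = D.

Definition colon C D : set K := [set xi | forall d, D d -> C (xi * d)].

(* For ideals with unique factorization the choice of s is immaterial. *)
Definition prime_divisors R C : set (set K) :=
  [set P | exists s : seq (set K),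
     [/\ forall Q, Q \in s -> prime_ideal R Q,
         \big[mul_ideal/[set` R]]_(Q <- s) Q = C & P \in s]].

Definition fractional R I :=
  submodule R I /\
  exists d, [/\ d \in R, d != 0 & forall a, I a -> d * a \in R].

Definition invertible R I :=
  fractional R I /\ exists2 J, fractional R J & mul_ideal I J = [set` R].

Lemma mul_ideal_ind I J (T : set K) :
  T 0 -> (forall a b, T a -> T b -> T (a + b)) ->
  (forall a b, I a -> J b -> T (a * b)) -> mul_ideal I J `<=` T.
Proof.
move=> T0 TD TM x [s sIJ ->]; elim: s sIJ => [|p s IHs] sIJ.
  by rewrite big_nil.
rewrite big_cons; apply: TD.
  by have [? ?] := sIJ p (mem_head _ _); apply: TM.
by apply: IHs => q qs; apply: sIJ; rewrite inE qs orbT.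
Qed.

Lemma mul_idealP I J a b : I a -> J b -> mul_ideal I J (a * b).
Proof.
by move=> Ia Jb; exists [:: (a, b)]; rewrite ?big_seq1// => p /[!inE] /eqP->.
Qed.

Lemma mul_ideal0 I J : mul_ideal I J 0.
Proof. by exists [::]; rewrite ?big_nil. Qed.

Lemma mul_idealD I J x y :
  mul_ideal I J x -> mul_ideal I J y -> mul_ideal I J (x + y).
Proof.
move=> [s sIJ ->] [t tIJ ->]; exists (s ++ t); last by rewrite big_cat.
by move=> p; rewrite mem_cat => /orP[/sIJ|/tIJ].
Qed.

Lemma mul_idealC : commutative mul_ideal.
Proof.
suff sub I J : mul_ideal I J `<=` mul_ideal J I.
  by move=> I J; apply/seteqP; split; apply: sub.
apply: mul_ideal_ind; [exact: mul_ideal0 | exact: mul_idealD |].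
by move=> a b Ia Jb; rewrite mulrC; apply: mul_idealP.
Qed.

Lemma mul_idealA : associative mul_ideal.
Proof.
have sub I J L : mul_ideal I (mul_ideal J L) `<=` mul_ideal (mul_ideal I J) L.
  apply: mul_ideal_ind; [exact: mul_ideal0 | exact: mul_idealD |].
  move=> a x Ia JLx; move: x JLx.
  apply: mul_ideal_ind => [|x y ? ?|b c Jb Lc].
  - by rewrite mulr0; apply: mul_ideal0.
  - by rewrite mulrDr; apply: mul_idealD.
  - by rewrite mulrA; do 2!apply: mul_idealP => //.
move=> I J L; apply/seteqP; split; first exact: sub.
rewrite mul_idealC (mul_idealC I J) (mul_idealC I) (mul_idealC J L).
exact: sub.
Qed.

End Ideals.

Section PicardGroup.
Variables (K : fieldType) (R : subringClosed K).
Implicit Types (I J : set K).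

Lemma mul_ideal1l I : submodule R I -> mul_ideal [set` R] I = I.
Proof.
move=> [I0 ID IM]; apply/seteqP; split.
  by apply: mul_ideal_ind => // a b /= Ra Ib; apply: IM.
by move=> a Ia; rewrite -[a]mul1r; apply: mul_idealP => //=; apply: rpred1.
Qed.

Lemma fractional1 : fractional R [set` R].
Proof.
split; first split=> /=; [exact: rpred0 | exact: rpredD | exact: rpredM |].
by exists 1; rewrite oner_neq0 rpred1; split=> // a; rewrite /= mul1r.
Qed.

Lemma fractionalM I J :
  fractional R I -> fractional R J -> fractional R (mul_ideal I J).
Proof.
move=> [[I0 ID IM] [d [Rd d0 dI]]] [[J0 JD JM] [e [Re e0 eJ]]]; split.
  split; [exact: mul_ideal0 | exact: mul_idealD |] => r x Rr; move: x.
  apply: mul_ideal_ind => [|x y ? ?|a b Ia Jb].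
  - by rewrite mulr0; apply: mul_ideal0.
  - by rewrite mulrDr; apply: mul_idealD.
  - by rewrite mulrA; apply: mul_idealP => //; apply: IM.
exists (d * e); rewrite mulf_neq0// rpredM//; split=> //.
apply: mul_ideal_ind => [|x y ? ?|a b Ia Jb].
- by rewrite mulr0 rpred0.
- by rewrite mulrDr rpredD.
- by rewrite mulrACA rpredM ?dI ?eJ.
Qed.

Lemma invertible1 : invertible R [set` R].
Proof.
split; first exact: fractional1.
exists [set` R]; first exact: fractional1.
by rewrite mul_ideal1l//; case: fractional1.
Qed.

Lemma invertibleM I J :
  invertible R I -> invertible R J -> invertible R (mul_ideal I J).
Proof.
move=> [fI [I' fI' II']] [fJ [J' fJ' JJ']]; split; first exact: fractionalM.
exists (mul_ideal I' J'); first exact: fractionalM.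
rewrite mul_idealA -(mul_idealA I J I') (mul_idealC J) (mul_idealA I) II'.
by rewrite -mul_idealA JJ' mul_ideal1l//; case: fractional1.
Qed.

Lemma invertibleV I : invertible R I ->
  {J | invertible R J & mul_ideal J I = [set` R]}.
Proof.
move=> [fI /cid2[J fJ IJ]]; exists J; last by rewrite mul_idealC.
by split=> //; exists I => //; rewrite mul_idealC.
Qed.

Record inv_ideal := InvIdeal {
  inv_ideal_set :> set K;
  inv_idealP : invertible R inv_ideal_set }.

HB.instance Definition _ := gen_eqMixin inv_ideal.
HB.instance Definition _ := gen_choiceMixin inv_ideal.

Lemma inv_ideal_inj (I J : inv_ideal) : I = J :> set K -> I = J.
Proof.
by case: I J => [I hI] [J hJ] /= IJ; case: _ / IJ hJ => hJ; congr InvIdeal.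
Qed.

Definition inv_ideal_one := InvIdeal invertible1.
Definition inv_ideal_mul (I J : inv_ideal) :=
  InvIdeal (invertibleM (inv_idealP I) (inv_idealP J)).
Definition inv_ideal_inv (I : inv_ideal) :=
  InvIdeal (s2valP (invertibleV (inv_idealP I))).

Lemma inv_ideal_mulA : associative inv_ideal_mul.
Proof. by move=> I J L; apply/inv_ideal_inj/mul_idealA. Qed.

Lemma inv_ideal_mulC : commutative inv_ideal_mul.
Proof. by move=> I J; apply/inv_ideal_inj/mul_idealC. Qed.

Lemma inv_ideal_mul1 : left_id inv_ideal_one inv_ideal_mul.
Proof.
move=> I; apply/inv_ideal_inj/mul_ideal1l.
by case: (inv_idealP I) => -[].
Qed.

Lemma inv_ideal_mulV : left_inverse inv_ideal_one inv_ideal_inv inv_ideal_mul.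
Proof. by move=> I; apply/inv_ideal_inj/(s2valP' (invertibleV _)). Qed.

(* The group of invertible fractional ideals, written additively: the group
   operation + is the product of ideals. *)
HB.instance Definition _ := GRing.isZmodule.Build inv_ideal
  inv_ideal_mulA inv_ideal_mulC inv_ideal_mul1 inv_ideal_mulV.

Definition principal : {pred inv_ideal} :=
  [pred I : inv_ideal | `[< exists2 x, x != 0 & I = prin_ideal R x :> set K >]].

Lemma principal_zmod_closed : zmod_closed principal.
Proof.
have mulp (I : set K) x : submodule R I ->
    mul_ideal I (prin_ideal R x) = scale_ideal x I.
  move=> [I0 ID IM]; apply/seteqP; split.
    apply: mul_ideal_ind.
    - by exists 0; rewrite ?mulr0.
    - move=> _ _ [a Ia <-] [b Ib <-].
      by exists (a + b); rewrite ?mulrDr//; apply: ID.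
    - move=> a _ Ia [r /= Rr <-]; exists (r * a); first exact: IM.
      by rewrite mulrC mulrCA mulrA.
  move=> _ [a Ia <-]; rewrite mulrC; apply: mul_idealP => //.
  by exists 1; rewrite ?mul1r//=; apply: rpred1.
split=> [|I J].
  apply/asboolP; exists 1; rewrite ?oner_neq0//.
  rewrite /prin_ideal; apply/seteqP; split=> [a Ra|_ [a Ra <-]].
    by exists a; rewrite ?mulr1.
  by rewrite mulr1.
move=> /asboolP[x x0 Ix] /asboolP[y y0 Jy]; apply/asboolP.
have sub (L : inv_ideal) : submodule R L by case: (inv_idealP L) => -[].
exists (x / y); first by rewrite mulf_neq0 ?invr_neq0.
have E : (I - J) + J = I by rewrite addrNK.
have {}E : scale_ideal y (I - J : inv_ideal) = I :> set K.
  by rewrite -mulp// -Jy; exact: (congr1 inv_ideal_set E).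
move: (I - J) E => D E; apply/seteqP; split=> [a Da|_ [r /= Rr <-]].
  have : (I : set K) (y * a) by rewrite -E; exists a.
  rewrite Ix => -[r Rr rx]; exists r => //=.
  by rewrite mulrA rx mulrC mulKf.
have : (I : set K) (r * x) by rewrite Ix; exists r.
by rewrite -E => -[a Da ya]; rewrite mulrA -ya mulrC mulKf.
Qed.

HB.instance Definition _ :=
  GRing.isZmodClosed.Build inv_ideal principal principal_zmod_closed.

(* Meaningful when K is the field of fractions of R. *)
Definition Pic : zmodType := Quotient.quot principal.

(* The class [I]; the junk value 0 is only taken off invertible ideals. *)
Definition pic_class I : Pic :=
  if pselect (invertible R I) is left hI then \pi_Pic (InvIdeal hI) else 0.

Definition conductor (S : {pred K}) : set K :=
  [set a | a \in S /\ forall b, b \in S -> a * b \in R].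

End PicardGroup.

Section Subgroups.
Variable G : zmodType.

Definition subgroup_gen (S : set G) : set G :=
  [set x | forall H : {pred G}, zmod_closed H -> S `<=` [set` H] -> x \in H].

Definition eq_mod (S : set G) (a b : G) := subgroup_gen S (a - b).

End Subgroups.

Section NumberField.
Variable K : fieldExtType rat.

Definition Zadjoin (x : K) : {pred K} :=
  [pred y | `[< exists p : {poly int}, y = (map_poly intr p).[x] >]].

Lemma Zadjoin_subring x : subring_closed (Zadjoin x).
Proof.
split=> [|_ _ /asboolP[p ->] /asboolP[q ->]|_ _ /asboolP[p ->] /asboolP[q ->]];
  apply/asboolP.
- by exists 1; rewrite rmorph1 hornerC.
- by exists (p - q); rewrite rmorphB/= hornerD hornerN.
- by exists (p * q); rewrite rmorphM/= hornerM.
Qed.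

HB.instance Definition _ x :=
  GRing.isSubringClosed.Build K (Zadjoin x) (Zadjoin_subring x).

Definition integers : {pred K} :=
  [pred y | `[< integralOver (intr : int -> K) y >]].

Lemma integers_subring : subring_closed integers.
Proof.
split=> [|x y /asboolP ix /asboolP iy|x y /asboolP ix /asboolP iy];
  apply/asboolP.
- exact: integral1.
- exact: integral_sub.
- exact: integral_mul.
Qed.

HB.instance Definition _ :=
  GRing.isSubringClosed.Build K integers integers_subring.

End NumberField.

Arguments integers : clear implicits.

(* The fractional ideals of the ring of integers, a Dedekind domain, are the
   invertible ones together with 0, so its ideal class group is its Picard
   group. *)
Definition Cl (K : fieldExtType rat) : zmodType := Pic (integers K).

Definition cl_class (K : fieldExtType rat) (I : set K) : Cl K :=
  pic_class (integers K) I.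

Definition prime_to_conductor (K : fieldExtType rat) (R : subringClosed K)
    (C : set K) :=
  add_ideal C (conductor R (integers K)) = [set` R].

(* Main.v *)
Require Import Defs.
From mathcomp Require Import all_boot all_order all_algebra all_field.
From mathcomp Require Import boolp classical_sets.
From mathcomp Require Import ring.
Set Implicit Arguments.
Unset Strict Implicit.
Unset Printing Implicit Defensive.
Import Order.TTheory GRing.Theory Num.Theory.
Local Open Scope ring_scope.
Local Open Scope classical_set_scope.

(** If xi carries the extension of A to Z[1/lam] onto that of B, clearing
    denominators on finitely many generators turns xi and 1/xi into y in (B : A)
    and x in (A : B) with x y = lam^k.  Then y A B^-1 and x B A^-1 are integral
    ideals with product (lam)^k, so if (lam) is a product of primes P_i, the
    first one is a product of P_i's, and its class is [A] - [B].  Conversely the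
    classes of the ideals of Z[lam] that become principal in Z[1/lam] form
    a subgroup of the Picard group containing the [P_i].

    The arithmetic of Z[lam] and of the ring of integers O_K comes from one
    fact: G / N G is finite for every additive subgroup G of K and N > 0.  It
    shows that O_K is completely integrally closed, and that every proper
    nonzero ideal J of O_K has xi J in O_K for some xi outside O_K; applied to
    J = I (O_K : I) this makes every nonzero ideal I invertible.  Ideals of
    Z[lam] prime to the conductor inherit invertibility, and factor into primes
    by induction on the number of residues modulo N that they miss. *)

(** * Finiteness of G / N G *)

Definition additive_subgroup (V : zmodType) (G : set V) :=
  G 0 /\ forall a b, G a -> G b -> G (a - b).

(** G is a subset and not a type, so finiteness of G / N G is expressed by a list of representatives
    in G, possibly with repetitions. *)
Definition finite_mod (V : zmodType) (G : set V) (N : nat) :=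
  exists2 s : seq V, forall r, r \in s -> G r &
    forall g, G g -> exists2 r, r \in s & exists2 h, G h & g = r + h *+ N.

Section AdditiveSubgroup.
Variables (V : zmodType) (G : set V).
Hypothesis hG : additive_subgroup G.

Lemma subgroup0 : G 0. Proof. by case: hG. Qed.

Lemma subgroupB a b : G a -> G b -> G (a - b).
Proof. by case: hG => _; apply. Qed.

Lemma subgroupN a : G a -> G (- a).
Proof. by rewrite -[- a]sub0r; apply: subgroupB subgroup0. Qed.

Lemma subgroupD a b : G a -> G b -> G (a + b).
Proof. by move=> Ga /subgroupN Gb; rewrite -[b]opprK; apply: subgroupB. Qed.

Lemma subgroupMn a n : G a -> G (a *+ n).
Proof.
move=> Ga; elim: n => [|n IHn]; first exact: subgroup0.
by rewrite mulrS; apply: subgroupD.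
Qed.

Lemma subgroupMz a z : G a -> G (a *~ z).
Proof.
move=> Ga; case: z => n; rewrite ?NegzE ?mulrNz -pmulrn.
  exact: subgroupMn.
exact/subgroupN/subgroupMn.
Qed.

End AdditiveSubgroup.

(** Over the common denominator [D], x and y become integers m and n, and Bezout coefficients of m
    and n give the generator gcd(m, n) / D of Z x + Z y. *)
Lemma rat_cyclic2 (x y : rat) : exists (u v a b : int),
  let z := u%:~R * x + v%:~R * y in x = z * a%:~R /\ y = z * b%:~R.
Proof.
have nz (t : rat) : (denq t)%:~R != 0 :> rat by rewrite intr_eq0 denq_neq0.
pose m := numq x * denq y; pose n := numq y * denq x.
have [u [v uv]] := Bezoutz m n.
have /dvdzP[a ma] : (gcdz m n %| m)%Z by rewrite dvdz_gcdl.
have /dvdzP[b nb] : (gcdz m n %| n)%Z by rewrite dvdz_gcdr.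
exists u, v, a, b => /=.
pose D : rat := (denq x)%:~R * (denq y)%:~R.
have xE : x = m%:~R / D.
  rewrite /D {1}[x](esym (divq_num_den x)) /m rmorphM /=.
  by field; rewrite !nz.
have yE : y = n%:~R / D.
  rewrite /D {1}[y](esym (divq_num_den y)) /n rmorphM /=.
  by field; rewrite !nz.
have zE : u%:~R * x + v%:~R * y =
    (gcdz m n)%:~R / D.
  rewrite -uv [in LHS]xE [in LHS]yE rmorphD !rmorphM /=.
  by rewrite !mulrA -mulrDl.
rewrite zE; split.
  by rewrite [LHS]xE {1}ma rmorphM /=; ring.
by rewrite [LHS]yE {1}nb rmorphM /=; ring.
Qed.

(** Any two elements of f(G) lie in a common cyclic subgroup, so f(G) / p f(G) is cyclic: either it
    is trivial, or the multiples i h0 with i < p represent it, for any h0 whose image is not in p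
    f(G). *)
Lemma finite_mod_image (V : zmodType) (f : {additive V -> rat}) (G : set V) p :
    additive_subgroup G -> prime p ->
  exists2 s : seq V, forall r, r \in s -> G r &
    forall g, G g ->
    exists2 r, r \in s & exists2 h, G h & f g = f (r + h *+ p).
Proof.
move=> hG pp.
have [[h0 [Gh0 h0p]]|noh] := pselect (exists h0, G h0 /\
    forall h, G h -> f h0 <> f (h *+ p)); last first.
  exists [:: 0]; first by move=> r /[!inE] /eqP->; apply: subgroup0.
  move=> g Gg; exists 0; rewrite ?inE//.
  apply: contrapT => nh; apply: noh; exists g; split=> // h Gh fgh.
  by apply: nh; exists h; rewrite ?add0r.
exists [seq h0 *+ i | i <- iota 0 p].
  by move=> _ /mapP[i _ ->]; apply: subgroupMn.
move=> g Gg; have [u [v [a [b [/= h0E gE]]]]] := rat_cyclic2 (f h0) (f g).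
pose k := h0 *~ u + g *~ v.
have Gk : G k by apply: subgroupD => //; apply: subgroupMz.
have fk : u%:~R * f h0 + v%:~R * f g = f k.
  by rewrite /k raddfD !raddfMz -[f h0 *~ u]mulrzl -[f g *~ v]mulrzl.
rewrite fk in h0E gE.
(* Here f h0 = a (f k) and f g = b (f k); if p divided a, then f h0 would lie in p f(G). *)
have : coprimez a p.
  rewrite coprimezE /= coprime_sym prime_coprime //; apply/negP => pa.
  have /dvdzP[c ac] : (p %| a)%Z by [].
  apply: (h0p (k *~ c)); first exact: subgroupMz.
  rewrite h0E ac raddfMn raddfMz /= rmorphM /= -mulr_natr -(mulrzr (f k) c).
  by rewrite mulrA (pmulrn 1).
move=> /coprimezP[[c d] /= cd].
(* Modulo p, c is an inverse of a, hence b = t a and f g is congruent to t (f h0). *)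
pose q := divz (b * c) p; pose t := modz (b * c) p.
have bcE : b * c = q * p + t by apply: divz_eq.
have p0 : (p : int) != 0 by rewrite -lt0n prime_gt0.
have t0 : 0 <= t by apply: modz_ge0.
have tp : t < p by apply: ltz_pmod; rewrite ltz_nat prime_gt0.
exists (h0 *+ `|t|%N).
  by apply/map_f; rewrite mem_iota /= add0n -ltz_nat gez0_abs.
exists (k *~ (q * a + b * d)); first exact: subgroupMz.
have bE : b = t * a + (q * a + b * d) * p.
  have -> : t = b * c - q * p by rewrite bcE; ring.
  by rewrite -[LHS]mulr1 -cd; ring.
rewrite raddfD !raddfMn raddfMz gE {1}bE h0E rmorphD !rmorphM /=.
rewrite -[t in LHS]gez0_abs //.
rewrite -[_ *+ `|t|]mulr_natr -[_ *+ p]mulr_natr -mulrzr.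
by rewrite -!pmulrn; ring.
Qed.

Lemma finite_modM (V : zmodType) (G : set V) m n : additive_subgroup G ->
  finite_mod G m -> finite_mod G n -> finite_mod G (m * n).
Proof.
move=> hG [s sG sP] [t tG tP].
exists [seq x + y *+ m | x <- s, y <- t].
  move=> _ /allpairsP[[x y] /= [xs yt ->]].
  by apply: subgroupD => //; [apply: sG|apply: subgroupMn => //; apply: tG].
move=> g /sP[r rs [h /tP[r' rt [h' Gh' ->]] ->]].
exists (r + r' *+ m); first by apply/allpairsP; exists (r, r').
by exists h' => //; rewrite mulrnDl addrA -mulrnA mulnC.
Qed.

(* Rational coordinates filter G with each successive quotient a subgroup of
   rat, whose quotient modulo a prime p is cyclic by [rat_cyclic2]. *)
Lemma finite_mod_prime (V : vectType rat) (G : set V) p :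
  additive_subgroup G -> prime p -> finite_mod G p.
Proof.
move=> hG pp; pose d := \dim (fullv : {vspace V}).
pose c (i : 'I_d) := coord (vbasis (fullv : {vspace V})) i.
have cB i x y : c i (x - y) = c i x - c i y by rewrite /c linearB.
pose F k : set V := [set x | G x /\ forall i : 'I_d, (k <= i)%N -> c i x = 0].
have hF k : additive_subgroup (F k).
  split; first by split=> [|i _]; [apply: subgroup0 | rewrite /c linear0].
  move=> a b [Ga a0] [Gb b0]; split=> [|i ki]; first exact: subgroupB.
  by rewrite cB a0 // b0 // subrr.
suff FP k : (k <= d)%N -> finite_mod (F k) p.
  have := FP d (leqnn d); suff -> : F d = G by [].
  apply/seteqP; split=> [x []//|x Gx]; split=> // i.
  by rewrite leqNgt ltn_ord.
elim: k => [_|k IHk kd].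
  exists [:: 0]; first by move=> r /[!inE] /eqP->; apply: subgroup0.
  move=> g [_ g0]; exists 0; rewrite ?inE //; exists 0.
    exact: subgroup0.
  rewrite mul0rn addr0 (coord_vbasis (memvf g)) big1 // => i _.
  by rewrite [coord _ _ _](g0 i (leq0n i)) scale0r.
have [s sF sP] := finite_mod_image (c (Ordinal kd)) (hF k.+1) pp.
have [t tF tP] := IHk (ltnW kd).
have sub x : F k x -> F k.+1 x.
  by case=> Gx x0; split=> // i /ltnW; apply: x0.
exists [seq x + y | x <- s, y <- t].
  move=> _ /allpairsP[[x y] /= [xs yt ->]].
  by apply: subgroupD => //; [apply: sF | apply/sub/tF].
move=> g Fg; have [r rs [h Fh gE]] := sP g Fg.
(* The representatives [s] are chosen by the k-th coordinate alone, so this difference has k-th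
   coordinate 0; it drops to [F k], where the induction hypothesis applies. *)
have Fg' : F k.+1 (g - (r + h *+ p)).
  apply: subgroupB => //; apply: subgroupD => //; first exact: sF.
  exact: subgroupMn.
have /tP[r' rt [h' Fh' E]] : F k (g - (r + h *+ p)).
  split=> [|i]; first by case: Fg'.
  rewrite leq_eqVlt => /predU1P[ki|]; last by case: Fg' => _; apply.
  have -> : i = Ordinal kd by apply: val_inj.
  by rewrite cB; apply/eqP; rewrite subr_eq0; apply/eqP/gE.
exists (r + r'); first by apply/allpairsP; exists (r, r').
exists (h + h'); first by apply: subgroupD => //; apply: sub.
by rewrite -[LHS](subrK (r + h *+ p)) E mulrnDl [RHS]addrACA addrC.
Qed.

Lemma finite_mod_gt0 (V : vectType rat) (G : set V) N :
  additive_subgroup G -> (0 < N)%N -> finite_mod G N.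
Proof.
move=> hG; elim/ltn_ind: N => N IHN N0.
have [N1|N1] := leqP N 1.
  have -> : N = 1%N by apply/eqP; rewrite eqn_leq N1.
  exists [:: 0]; first by move=> r /[!inE] /eqP->; apply: subgroup0.
  move=> g Gg; exists 0; first by rewrite inE.
  by exists g; rewrite ?add0r.
have pN := pdiv_prime N1.
rewrite -(divnK (pdiv_dvd N)) mulnC; apply: finite_modM => //.
  exact: finite_mod_prime.
by apply: IHN; rewrite ?ltn_Pdiv ?prime_gt1 // divn_gt0 ?pdiv_gt0 // pdiv_leq.
Qed.

(** * Ideals of a subring of a field *)

Section Ideals.
Variable K : fieldType.

Lemma ideal_neq0 (R : {pred K}) (I : set K) :
  submodule R I -> I <> [set 0] -> exists2 a, I a & a != 0.
Proof.
move=> [I0 _ _] In; apply: contrapT => nI; apply: In.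
apply/seteqP; split=> [a Ia|_ ->//].
by apply/eqP/negPn/negP => a0; apply: nI; exists a.
Qed.

Lemma additive_subgroup_subring (R : subringClosed K) :
  additive_subgroup [set` R].
Proof. by split=> [|a b] /=; [apply: rpred0|apply: rpredB]. Qed.

Lemma submodule_subgroup (R : subringClosed K) I :
  submodule R I -> additive_subgroup I.
Proof.
move=> [I0 ID IM]; split=> // a b Ia Ib; apply: ID => //.
by rewrite -mulN1r; apply: IM => //; rewrite rpredN rpred1.
Qed.

Lemma ideal1 (R : subringClosed K) I : is_ideal R I -> I 1 -> I = [set` R].
Proof.
move=> [IR [_ _ IM]] I1; apply/seteqP; split=> // r Rr.
by rewrite -[r]mulr1; apply: IM.
Qed.

Lemma ideal_fractional (R : subringClosed K) I : is_ideal R I -> fractional R I.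
Proof.
move=> [IR hI]; split=> //; exists 1; rewrite rpred1 oner_neq0; split=> // a.
by rewrite mul1r => /IR.
Qed.

Lemma submodule_mul (R : subringClosed K) I J :
  submodule R I -> submodule R (mul_ideal I J).
Proof.
move=> [I0 ID IM]; split; [exact: mul_ideal0|exact: mul_idealD|].
move=> r x Rr; move: x; apply: mul_ideal_ind => [|x y ? ?|a b Ia Jb].
- by rewrite mulr0; apply: mul_ideal0.
- by rewrite mulrDr; apply: mul_idealD.
- by rewrite mulrA; apply: mul_idealP => //; apply: IM.
Qed.

Lemma mul_ideal_sub (R : subringClosed K) I J :
  is_ideal R I -> submodule R J -> mul_ideal I J `<=` J.
Proof.
move=> [IR _] [J0 JD JM]; apply: mul_ideal_ind => // a b Ia Jb.
by apply: JM => //; apply: IR.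
Qed.

Lemma mul_ideal1r (R : subringClosed K) I :
  submodule R I -> mul_ideal I [set` R] = I.
Proof. by move=> hI; rewrite mul_idealC mul_ideal1l. Qed.

Lemma ideal_extension (S : subringClosed K) (A : set K) :
  A `<=` [set` S] -> is_ideal S (mul_ideal [set` S] A).
Proof.
move=> AS; split.
  apply: mul_ideal_ind => [|a b Ra Rb|a b Sa Ab] /=; rewrite ?rpred0 ?rpredD //.
  by rewrite rpredM //; apply: AS.
split; [exact: mul_ideal0|exact: mul_idealD|move=> r x Sr].
move: x; apply: mul_ideal_ind => [|a b ? ?|a b /= Sa Ab].
- by rewrite mulr0; apply: mul_ideal0.
- by rewrite mulrDr; apply: mul_idealD.
- by rewrite mulrA; apply: mul_idealP => //=; apply: rpredM.
Qed.

Lemma sub_extension (S : subringClosed K) (A : set K) :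
  A `<=` mul_ideal [set` S] A.
Proof.
by move=> a Aa; rewrite -[a]mul1r; apply: mul_idealP => //=; apply: rpred1.
Qed.

Lemma adjoin_ideal (R : subringClosed K) C a : is_ideal R C -> a \in R ->
  is_ideal R (add_ideal C (prin_ideal R a)).
Proof.
move=> [CR [C0 CD CM]] Ra; split.
  move=> _ [c [_ [Cc [r /= Rr <-] ->]]] /=.
  by rewrite rpredD ?rpredM //; apply: CR.
split.
- exists 0, 0; split; rewrite ?addr0 //.
  by exists 0; rewrite ?mul0r //=; apply: rpred0.
- move=> _ _ [c [_ [Cc [r /= Rr <-] ->]]] [d [_ [Cd [t /= Rt <-] ->]]].
  exists (c + d), ((r + t) * a); split; first exact: CD.
    by exists (r + t) => //=; apply: rpredD.
  by ring.
- move=> u _ Ru [c [_ [Cc [r /= Rr <-] ->]]].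
  exists (u * c), (u * r * a); split; first exact: CM.
    by exists (u * r) => //=; apply: rpredM.
  by ring.
Qed.

Lemma sub_adjoin (R : subringClosed K) C a :
  C `<=` add_ideal C (prin_ideal R a).
Proof.
move=> c Cc; exists c, 0; rewrite addr0; split=> //.
by exists 0; rewrite ?mul0r //=; apply: rpred0.
Qed.

Lemma mem_adjoin (R : subringClosed K) C a : submodule R C ->
  add_ideal C (prin_ideal R a) a.
Proof.
move=> [C0 _ _]; exists 0, a; rewrite add0r; split=> //.
by exists 1; rewrite ?mul1r //=; apply: rpred1.
Qed.

Lemma colon_submodule (R : subringClosed K) I :
  submodule R I -> submodule R (colon [set` R] I).
Proof.
move=> [I0 ID IM]; split=> [i _|a b aI bI i Ii|r a Rr aI i Ii] /=.
- by rewrite mul0r rpred0.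
- by rewrite mulrDl rpredD ?aI ?bI.
- by rewrite -mulrA rpredM ?aI.
Qed.

Lemma fractional_colon (R : subringClosed K) I a :
  is_ideal R I -> I a -> a != 0 -> fractional R (colon [set` R] I).
Proof.
move=> [IR hI] Ia a0; split; first exact: colon_submodule.
by exists a; split=> // [|c /(_ a Ia)]; [apply: IR|rewrite mulrC].
Qed.

Lemma mul_colon_ideal (R : subringClosed K) I :
  submodule R I -> is_ideal R (mul_ideal I (colon [set` R] I)).
Proof.
move=> hI; have [_ _ IM] := hI; split.
  apply: mul_ideal_ind => [|a b Ra Rb|a b Ia bI] /=.
  - exact: rpred0.
  - exact: rpredD.
  - by rewrite mulrC; apply: bI.
split; [exact: mul_ideal0|exact: mul_idealD|move=> r x Rr].
move: x; apply: mul_ideal_ind => [|a b ? ?|a b Ia bI].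
- by rewrite mulr0; apply: mul_ideal0.
- by rewrite mulrDr; apply: mul_idealD.
- by rewrite mulrA; apply: mul_idealP => //; apply: IM.
Qed.

(** An inverse of I can only be (R : I), and I (R : I) is an ideal of R, so invertibility comes down
    to this ideal containing 1. *)
Lemma invertible_colon (R : subringClosed K) I a : is_ideal R I -> I a ->
  a != 0 -> mul_ideal I (colon [set` R] I) 1 -> invertible R I.
Proof.
move=> hI Ia a0 I1; split; first exact: ideal_fractional.
exists (colon [set` R] I); first exact: fractional_colon hI Ia a0.
by apply: ideal1 I1; apply: mul_colon_ideal; case: hI.
Qed.

End Ideals.

(** * Invertibility in the ring of integers *)

(** Among the first [(size s).+1] values of f, two share a representative modulo N. *)
Lemma finite_mod_pigeonhole (V : zmodType) (G : set V) N (f : nat -> V) :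
  additive_subgroup G -> finite_mod G N -> (forall n, G (f n)) ->
  exists i j h, [/\ (i < j)%N, G h & f j = f i + h *+ N].
Proof.
move=> hG [s sG sP] fG.
have /choice[r rP] n : exists r, r \in s /\ exists2 h, G h & f n = r + h *+ N.
  by have [r rs rh] := sP _ (fG n); exists r.
have: ~~ uniq [seq r n | n <- iota 0 (size s).+1].
  apply/negP => /uniq_leq_size us; have /us : {subset
      [seq r n | n <- iota 0 (size s).+1] <= s}.
    by move=> _ /mapP[n _ ->]; case: (rP n).
  by rewrite size_map size_iota ltnn.
move=> /(uniqPn 0)[i [j []]].
rewrite size_map size_iota => ij js.
rewrite !(nth_map 0%N) ?size_iota ?(ltn_trans ij) //.
rewrite !nth_iota ?(ltn_trans ij) // !add0n => rij.
have [[_ [h Gh fi]] [_ [h' Gh' fj]]] := (rP i, rP j).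
exists i, j, (h' - h); split=> //; first exact: subgroupB.
by rewrite fi fj rij mulrnBl (addrC (h' *+ N)) addrA addrK.
Qed.

Section Integers.
Variable K : fieldExtType rat.
Local Notation OK := (integers K).

Lemma fieldExt_natr_eq0 n : (n%:R == 0 :> K) = (n == 0%N).
Proof. by rewrite -scaler_nat scaler_eq0 oner_eq0 orbF pnatr_eq0. Qed.

Lemma horner_intr_in (R : subringClosed K) (p : {poly int}) a :
  a \in R -> (map_poly intr p).[a] \in R.
Proof.
move=> Ra; rewrite horner_coef; apply: rpred_sum => i _.
by rewrite coef_map rpredM ?rpredX ?rpred_int.
Qed.

(** Once powers of X are divided out of an equation of a, the constant term c is nonzero and equals
    -a q(a) for an integer polynomial q; N is |c|, and the cofactor lies in R because a does. *)
Lemma dvd_nat_integer (R : subringClosed K) (a : K) :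
    a \in OK -> a \in R -> a != 0 ->
  exists2 N : nat, (0 < N)%N & exists2 b, b \in R & N%:R = a * b.
Proof.
move=> /asboolP[p pm pa] Ra a0; have {pm} : p != 0 by apply: monic_neq0.
elim/poly_ind: p pa => [|p c IHp]; first by rewrite eqxx.
rewrite rootE rmorphD rmorphM /= map_polyX map_polyC /= hornerMXaddC.
have [->|c0] := eqVneq c 0.
  rewrite addr0 addr0 mulf_eq0 (negPf a0) orbF -rootE => /IHp pN.
  by rewrite mulf_eq0 negb_or => /andP[/pN].
move=> + _; rewrite addr_eq0 => /eqP E.
exists `|c|%N; first by rewrite absz_gt0.
exists (- (-1) ^+ (c < 0)%R * (map_poly intr p).[a]).
  by rewrite rpredM ?rpredN ?rpred_sign ?horner_intr_in.
rewrite mulrCA [a * _]mulrC E mulrNN pmulrn abszE normrEsign.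
by rewrite rmorphM rmorph_sign.
Qed.

(** A multiple N of a gives N xi^k in O_K for all k. The pigeonhole principle modulo N^2 yields xi^j
    = xi^i + N h with i < j and h in O_K, so xi is a root of a monic polynomial with integral
    coefficients. *)
Lemma integers_complete (a xi : K) : a \in OK -> a != 0 ->
  (forall k, a * xi ^+ k \in OK) -> xi \in OK.
Proof.
move=> aO a0 axO.
have [N N0 [b bO Nab]] := dvd_nat_integer aO aO a0.
have NN0 : (0 < N * N)%N by rewrite muln_gt0 N0.
have hO := additive_subgroup_subring (integers K).
have hf n : [set` OK] (N%:R * xi ^+ n).
  by rewrite /= Nab [a * b]mulrC -mulrA rpredM.
have [i [j [h [ij Oh E]]]] :=
  finite_mod_pigeonhole hO (finite_mod_gt0 hO NN0) hf.
have {}E : xi ^+ j = xi ^+ i + N%:R * h.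
  have NK0 : N%:R != 0 :> K by rewrite fieldExt_natr_eq0 -lt0n.
  by apply: (mulfI NK0); rewrite E mulrDr mulrA -natrM (mulr_natl h).
pose p : {poly K} := 'X^j - ('X^i + (N%:R * h)%:P).
apply/asboolP; apply: (@integral_root_monic _ _ (intmul 1) _ p).
- rewrite monicE lead_coefDl ?lead_coefXn //.
  rewrite size_polyN size_polyXn ltnS; apply: (leq_trans (size_polyD _ _)).
  rewrite geq_max size_polyXn ij (leq_trans (size_polyC_leq1 _)) //.
  exact: leq_ltn_trans ij.
- by rewrite rootE !hornerE E subrr.
- apply/integral_poly => k.
  suff /asboolP : p`_k \in OK by [].
  by rewrite !coefE rpredB ?rpredD ?rpred_nat //; case: ifP => _;
    rewrite ?rpred0 ?rpredM ?rpred_nat.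
Qed.

(** Such an N puts N R inside I, so that questions about I pass to the finite quotient R / N R. *)
Lemma ideal_nat (R : subringClosed K) I a : {subset R <= OK} ->
  is_ideal R I -> I a -> a != 0 -> exists2 N, (0 < N)%N & I N%:R.
Proof.
move=> RO [IR [_ _ IM]] Ia a0; have Ra : a \in R by apply: IR.
have [N N0 [b Rb Nab]] := dvd_nat_integer (RO _ Ra) Ra a0.
by exists N => //; rewrite Nab mulrC; apply: IM.
Qed.

(* A product b of factors 1 - j ^+ k, one for each residue j of J modulo N, is
   nonzero modulo N since b = 1 modulo J, and powers of each j kill b modulo N;
   multiplying b by each j as often as possible gives N * xi. *)
Lemma proper_ideal_colon (R : subringClosed K) J N : is_ideal R J ->
    (0 < N)%N -> J N%:R -> ~ J 1 ->
  exists2 xi, xi \notin R & forall j, J j -> xi * j \in R.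
Proof.
move=> [JR subJ] N0 JN J1; have [J0 JD JM] := subJ.
have NK : N%:R != 0 :> K by rewrite fieldExt_natr_eq0 -lt0n.
have hJ := submodule_subgroup subJ.
(* The powers of j repeat modulo N: if j^l = j^i modulo N R with i < l, then j^i (1 - j^(l - i))
   lies in N R. *)
have nilp j : J j ->
    exists m k, (0 < k)%N /\ j ^+ m * (1 - j ^+ k) / N%:R \in R.
  move=> Jj; have hR := additive_subgroup_subring R.
  have Rj n : [set` R] (j ^+ n) by apply: rpredX; apply: JR.
  have [i [l [h [il Rh E]]]] :=
    finite_mod_pigeonhole hR (finite_mod_gt0 hR N0) Rj.
  exists i, (l - i)%N; rewrite subn_gt0; split=> //.
  rewrite mulrBr mulr1 -exprD subnKC ?(ltnW il) // E -(mulr_natl h).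
  by rewrite opprD addrA subrr sub0r mulNr mulrAC divff // mul1r rpredN.
have step1 (s : seq K) : (forall j, j \in s -> J j) -> exists2 b, b \in R &
    J (1 - b) /\ forall j, j \in s -> exists m, j ^+ m * b / N%:R \in R.
  elim: s => [|j s IHs] sJ.
    by exists 1; rewrite ?rpred1 // subrr.
  have [i si|b Rb [Jb bs]] := IHs; first by apply: sJ; rewrite inE si orbT.
  have Jj : J j by apply: sJ; apply: mem_head.
  have Rj : j \in R by apply: JR.
  have [m [k [k0 jmk]]] := nilp j Jj.
  have Rjk : 1 - j ^+ k \in R by rewrite rpredB ?rpred1 ?rpredX.
  exists (b * (1 - j ^+ k)); first by rewrite rpredM.
  split.
    have -> : 1 - b * (1 - j ^+ k) = (1 - b) + b * j ^+ k.
      by ring.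
    apply: JD => //; rewrite -(prednK k0) exprSr mulrA; apply: JM => //.
    by rewrite rpredM ?rpredX.
  move=> i /[!inE] /predU1P[->|/bs[n bn]].
    by exists m; rewrite mulrCA -mulrA rpredM.
  by exists n; rewrite mulrA mulrAC rpredM.
have step2 (s : seq K) b : (forall j, j \in s -> j \in R) -> b \in R ->
    b / N%:R \notin R ->
    (forall j, j \in s -> exists m, j ^+ m * b / N%:R \in R) ->
    exists2 c, c \in R & b * c / N%:R \notin R /\
      forall j, j \in s -> j * (b * c) / N%:R \in R.
  elim: s b => [|j s IHs] b sR Rb bN bs.
    by exists 1; rewrite ?rpred1 // mulr1.
  have sR' i : i \in s -> i \in R by move=> si; apply: sR; rewrite inE si orbT.
  have Rj : j \in R by apply: sR; apply: mem_head.
  have exm := bs j (mem_head _ _).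
  (* The least exponent that brings j^e b into N R is positive, as b itself is outside N R. With e =
     m + 1, the element j^m b is still outside while j times it is inside. *)
  case: (ex_minnP exm) => -[|m]; first by rewrite mul1r (negPf bN).
  move=> jm mmin; pose b1 := j ^+ m * b.
  have [||||c Rc [cN cs]] := IHs b1 => //.
  - by rewrite rpredM ?rpredX.
  - by apply/negP => /mmin; rewrite ltnn.
  - move=> i si; have [|n bn] := bs i; first by rewrite inE si orbT.
    by exists n; rewrite mulrCA -mulrA rpredM ?rpredX.
  exists (j ^+ m * c); first by rewrite rpredM ?rpredX.
  have E : b * (j ^+ m * c) = b1 * c by rewrite mulrA [b * _]mulrC.
  rewrite E; split=> // i /[!inE] /predU1P[->|/cs//].
  by rewrite mulrA mulrAC rpredM // /b1 mulrA -exprS.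
have [s sJ sP] := finite_mod_gt0 hJ N0.
have [b Rb [Jb bs]] := step1 s sJ.
have [||c Rc [bcN cs]] := step2 s b _ Rb _ bs.
- by move=> j /sJ /JR.
(* If b were in N R, it would be in J, and 1 = (1 - b) + b would be in J too. *)
- apply/negP => bN; apply: J1; rewrite -(subrK b 1); apply: JD => //.
  by rewrite -(divfK NK b); apply: JM.
exists (b * c / N%:R) => // j /sP[r rs [h /JR Rh ->]].
rewrite mulrDr rpredD //; first by rewrite mulrAC [_ * r]mulrC cs.
by rewrite -(mulr_natl h) mulrA divfK // !rpredM.
Qed.

(** If J = I (O_K : I) were proper, there would be xi outside O_K with xi J in O_K. Then xi (O_K :
    I) is contained in (O_K : I), so every xi^k lies in (O_K : I) and N xi^k in O_K for an N in I,
    which forces xi into O_K. *)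
Lemma integers_ideal_invertible I :
  is_ideal OK I -> I <> [set 0] -> invertible OK I.
Proof.
move=> hI I_nz; have [IR subI] := hI; have [a Ia a0] := ideal_neq0 subI I_nz.
apply: (invertible_colon hI Ia a0); apply: contrapT => J1.
have [N N0 IN] := ideal_nat (fun _ => id) hI Ia a0.
set I' := colon _ I in J1.
have I'1 : I' 1 by move=> i Ii; rewrite mul1r; apply: IR.
have JN : mul_ideal I I' N%:R by rewrite -[N%:R]mulr1; apply: mul_idealP.
have [xi xiO xiJ] := proper_ideal_colon (mul_colon_ideal subI) N0 JN J1.
have I'xi k : I' (xi ^+ k).
  elim: k => [//|k IHk] i Ii; rewrite exprS -mulrA; apply: xiJ.
  by rewrite mulrC; apply: mul_idealP.
move/negP: xiO; apply; apply: (@integers_complete N%:R).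
- exact: rpred_nat.
- by rewrite fieldExt_natr_eq0 -lt0n.
- by move=> k; rewrite mulrC; apply: I'xi.
Qed.

End Integers.

(** * Ideals prime to the conductor *)

Section Coprime.
Variable K : fieldExtType rat.
Local Notation OK := (integers K).

Lemma prime_to_conductorE (R : subringClosed K) C :
    {subset R <= OK} -> is_ideal R C ->
  prime_to_conductor R C <-> exists2 a, C a & conductor R OK (1 - a).
Proof.
move=> RO [CR [_ _ CM]]; split=> [CE|[a Ca fa]].
  have : [set` R] 1 by apply: rpred1.
  by rewrite -CE => -[a [c [Ca fc ->]]]; exists a; rewrite // addrC addKr.
apply/seteqP; split=> [_ [b [c [Cb [_ fc] ->]]]|r Rr] /=.
  by rewrite rpredD //; [apply: CR|rewrite -[c]mulr1 fc ?rpred1].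
exists (r * a), (r * (1 - a)); split; first exact: CM.
  case: fa => aO fa; split; first by rewrite rpredM // RO.
  by move=> b bO; rewrite -mulrA rpredM ?fa.
by ring.
Qed.

(* If 1 = a + c with a in A and c in the conductor, then c maps the
   inverse of the extension of A to the integers into the colon (R : A). *)
Lemma coprime_invertible (R : subringClosed K) A :
    {subset R <= OK} -> is_ideal R A -> A <> [set 0] ->
    prime_to_conductor R A -> invertible R A.
Proof.
move=> RO hA A_nz /(prime_to_conductorE RO hA)[a Aa [_ fc]].
have [AR subA] := hA; have [b Ab b0] := ideal_neq0 subA A_nz.
apply: (invertible_colon hA Ab b0).
set A' := colon _ A.
have hAA' : is_ideal R (mul_ideal A A') by apply: mul_colon_ideal.
have hAO : is_ideal OK (mul_ideal [set` OK] A).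
  by apply: ideal_extension => x /AR /RO.
have [|_ [J [[J0 JD JM] _] AJ]] := integers_ideal_invertible hAO.
  move=> AO0; have : mul_ideal [set` OK] A b by apply: sub_extension.
  by rewrite AO0 => /= /eqP; rewrite (negPf b0).
set c := 1 - a in fc.
have cJ j : J j -> A' (c * j).
  move=> Jj d Ad /=; rewrite -mulrA fc // mulrC.
  have : mul_ideal (mul_ideal [set` OK] A) J (d * j).
    by apply: mul_idealP => //; apply: sub_extension.
  by rewrite AJ.
have sub : mul_ideal (mul_ideal [set` OK] A) J `<=`
    [set x | mul_ideal A A' (c * x)].
  apply: mul_ideal_ind => [|x y ? ?|x j + Jj] /=.
  - by rewrite mulr0; apply: mul_ideal0.
  - by rewrite mulrDr; apply: mul_idealD.
  move: x; apply: mul_ideal_ind => [|x y ? ?|o d Oo Ad] /=.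
  - by rewrite mul0r mulr0; apply: mul_ideal0.
  - by rewrite [(x + y) * j]mulrDl [c * _]mulrDr; apply: mul_idealD.
  - rewrite [o * d]mulrC -mulrA mulrCA; apply: mul_idealP => //.
    by apply: cJ; apply: JM.
(* In 1 = (1 - a) + a, the first term lies in A A' by [sub] at 1, and the second because A' contains
   1. *)
rewrite -(subrK a 1); apply: mul_idealD.
  by rewrite -[1 - a]mulr1; apply: sub; rewrite AJ /= rpred1.
rewrite -[a]mulr1; apply: mul_idealP => //.
by move=> d /AR; rewrite mul1r.
Qed.

(** An ideal containing N is a union of residue classes modulo N, so the number of representatives
    it misses drops when it grows strictly. This measure takes the place of Noetherian induction. *)
Lemma ideal_measure (R : subringClosed K) N : (0 < N)%N ->
  exists mu : set K -> nat, forall C D, is_ideal R C -> is_ideal R D ->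
    C N%:R -> C `<=` D -> C <> D -> (mu D < mu C)%N.
Proof.
move=> N0.
have [s sR sP] := finite_mod_gt0 (additive_subgroup_subring R) N0.
exists (fun C => count (fun r => `[< ~ C r >]) s).
move=> C D [_ [_ CD CM]] hD CN sCD CneD.
have [x Dx nCx] : exists2 x, D x & ~ C x.
  apply: contrapT => nx; apply: CneD; apply/seteqP; split=> // x Dx.
  by apply: contrapT => nCx; apply: nx; exists x.
have [r rs [h Rh xE]] := sP x (hD.1 _ Dx).
have ChN : C (h *+ N) by rewrite -mulr_natr; apply: CM.
have nCr : ~ C r by move=> Cr; apply: nCx; rewrite xE; apply: CD.
have Dr : D r.
  have hD' := submodule_subgroup hD.2.
  have -> : r = x - h *+ N by rewrite xE addrK.
  by apply: subgroupB => //; apply: sCD.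
(* [b] marks the representatives outside D and [a] those outside C; b implies a, and r is marked by
   a only. *)
set b := fun r => _; set a := fun r => _.
have := count_predUI b (predD a b) s.
have -> : count (predI b (predD a b)) s = 0%N.
  rewrite -(count_pred0 s); apply: eq_count => y /=.
  by case: (b y).
rewrite addn0 => E.
apply: (@leq_trans (count (predU b (predD a b)) s)).
  rewrite E -addn1 leq_add2l -has_count; apply/hasP; exists r => //=.
  by apply/andP; split; [apply/negP => /asboolP|apply/asboolP].
apply: sub_count => y /= /orP[/asboolP nDy|/andP[]//].
by apply/asboolP => /sCD.
Qed.

(** If C is not prime, some product a b lies in C with a and b outside. One of C + (a) and C + (b)
    is proper, since their product lies in C, and induction applies to that larger ideal. *)
Lemma prime_above (R : subringClosed K) C N : (0 < N)%N -> is_ideal R C ->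
  C N%:R -> ~ C 1 -> exists2 P, prime_ideal R P & C `<=` P.
Proof.
move=> N0; have [mu muP] := ideal_measure R N0.
have [m] := ubnP (mu C); elim: m C => // m IHm C mC hC CN C1.
have [CR subC] := hC; have [_ CD CM] := subC.
have [pC|npC] := pselect (prime_ideal R C); first by exists C.
have [a [b [Ra Rb Cab nCa nCb]]] : exists a b,
    [/\ a \in R, b \in R, C (a * b), ~ C a & ~ C b].
  apply: contrapT => nab; apply: npC; split=> // a b Ra Rb Cab.
  have [Ca|nCa] := pselect (C a); first by left.
  right; apply: contrapT => nCb; apply: nab; by exists a, b.
have step x : x \in R -> ~ C x -> ~ add_ideal C (prin_ideal R x) 1 ->
    exists2 P, prime_ideal R P & C `<=` P.
  move=> Rx nCx Cx1.
  have hx := adjoin_ideal hC Rx; have sx := @sub_adjoin _ R C x.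
  have [||P pP CxP] := IHm _ _ hx _ Cx1; last by exists P => // y /sx /CxP.
    rewrite -ltnS (leq_trans _ mC) // ltnS; apply: muP => // E.
    by apply: nCx; rewrite E; apply: mem_adjoin.
  exact: sx.
have [Ca1|] := pselect (add_ideal C (prin_ideal R a) 1); last exact: step.
have [Cb1|] := pselect (add_ideal C (prin_ideal R b) 1); last exact: step.
exfalso; apply: C1.
have [c [_ [Cc [r /= Rr <-] E1]]] := Ca1.
have [d [_ [Cd [t /= Rt <-] E2]]] := Cb1.
have -> : 1 = (d + t * b) * c + ((r * a) * d + (r * t) * (a * b)).
  by transitivity ((c + r * a) * (d + t * b)); [rewrite -E1 -E2 mulr1|ring].
have Rd := CR _ Cd.
by apply: (CD); [|apply: (CD)]; apply: (CM) => //; rewrite -?E2 ?rpred1 ?rpredM.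
Qed.

(** With P a prime above C and J its inverse, C = P (C J), and C J is a strictly larger ideal that
    still contains N and is prime to the conductor. *)
Lemma prime_factorization (R : subringClosed K) C N : {subset R <= OK} ->
    (0 < N)%N -> is_ideal R C -> C N%:R -> prime_to_conductor R C ->
  exists2 s : seq (set K), forall Q, Q \in s -> prime_ideal R Q &
    \big[@mul_ideal K/[set` R]]_(Q <- s) Q = C.
Proof.
move=> RO N0; have [mu muP] := ideal_measure R N0.
have inv D : is_ideal R D -> D N%:R -> prime_to_conductor R D -> invertible R D.
  move=> hD DN fD; apply: coprime_invertible => // D0.
  move: DN; rewrite D0 /= => /eqP.
  by rewrite fieldExt_natr_eq0 -leqn0 leqNgt N0.
have up D E : is_ideal R D -> is_ideal R E -> D `<=` E ->
    prime_to_conductor R D -> prime_to_conductor R E.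
  move=> hD hE DE /(prime_to_conductorE RO hD)[a Da fa].
  by apply/prime_to_conductorE => //; exists a => //; apply: DE.
have [m] := ubnP (mu C); elim: m C => // m IHm C mC hC CN fC.
have [C1|C1] := pselect (C 1).
  by exists [::] => //; rewrite big_nil (ideal1 hC).
have [P pP CP] := prime_above N0 hC CN C1.
have [hP P1 _] := pP.
have [_ [J [subJ _] PJ]] : invertible R P.
  by apply: inv => //; [apply: CP|apply: up fC].
have [_ [C'' _ CC'']] := inv C hC CN fC.
have [CR subC] := hC.
have J1 : J 1.
  by apply: (mul_ideal_sub hP subJ); rewrite PJ /= rpred1.
pose C' := mul_ideal C J.
have CC' : C `<=` C' by move=> c Cc; rewrite -[c]mulr1; apply: mul_idealP.
have hC' : is_ideal R C'.
  split; last exact: submodule_mul.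
  rewrite -PJ; apply: mul_ideal_ind => [|a b|a b Ca Jb].
  - exact: mul_ideal0.
  - exact: mul_idealD.
  - by apply: mul_idealP => //; apply: CP.
(* Cancelling the invertible C in C = C J would give J = R, and then P = P J = R. *)
have CneC' : C <> C'.
  move=> E; have RJ : [set` R] = J.
    rewrite -CC'' {1}E /C' [mul_ideal C J]mul_idealC -mul_idealA CC''.
    by rewrite mul_ideal1r.
  by apply: P1; rewrite -(mul_ideal1r hP.2) RJ PJ /= rpred1.
have [|||s sP sE] := IHm C' _ hC'.
- by rewrite -ltnS (leq_trans _ mC) // ltnS muP.
- exact: CC'.
- exact: up fC.
exists (P :: s); first by move=> Q /[!inE] /predU1P[->|/sP].
by rewrite big_cons sE /C' mul_idealC -mul_idealA [mul_ideal J P]mul_idealC PJ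
  mul_ideal1r.
Qed.

End Coprime.

(** * Classes in the Picard group *)

Local Open Scope quotient_scope.

Section PicardClasses.
Variables (K : fieldType) (R : subringClosed K).
Implicit Types (I J C D P : set K) (x y : K).

Lemma scale_ideal1 I : scale_ideal 1 I = I.
Proof.
apply/seteqP; split=> [_ [a Ia <-]|a Ia]; first by rewrite mul1r.
by exists a; rewrite ?mul1r.
Qed.

Lemma scale_idealM x y I :
  scale_ideal x (scale_ideal y I) = scale_ideal (x * y) I.
Proof.
apply/seteqP; split=> [_ [_ [a Ia <-] <-]|_ [a Ia <-]].
  by exists a; rewrite ?mulrA.
by exists (y * a); [exists a|rewrite mulrA].
Qed.

Lemma mul_scale_ideal x I J :
  mul_ideal (scale_ideal x I) J = scale_ideal x (mul_ideal I J).
Proof.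
apply/seteqP; split.
  apply: mul_ideal_ind => [|_ _ [a ? <-] [b ? <-]|_ b [a Ia <-] Jb].
  - by exists 0; rewrite ?mulr0 //; apply: mul_ideal0.
  - by exists (a + b); rewrite ?mulrDr //; apply: mul_idealD.
  - by exists (a * b); rewrite ?mulrA //; apply: mul_idealP.
suff sub : mul_ideal I J `<=` [set a | mul_ideal (scale_ideal x I) J (x * a)].
  by move=> _ [a /sub ? <-].
apply: mul_ideal_ind => [|a b ? ?|a b Ia Jb] /=.
- by rewrite mulr0; apply: mul_ideal0.
- by rewrite mulrDr; apply: mul_idealD.
- by rewrite mulrA; apply: mul_idealP => //; exists a.
Qed.

Lemma prin_idealE x : prin_ideal R x = scale_ideal x [set` R].
Proof.
by apply/seteqP; split=> _ [r Rr <-]; exists r; rewrite // mulrC.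
Qed.

Lemma submodule_ring : submodule R [set` R].
Proof. by case: (fractional1 R). Qed.

Lemma scale_submodule x I : submodule R I -> submodule R (scale_ideal x I).
Proof.
move=> [I0 ID IM]; split.
- by exists 0; rewrite ?mulr0.
- by move=> _ _ [a Ia <-] [b Ib <-]; exists (a + b);
    rewrite ?mulrDr //; apply: ID.
- by move=> r _ Rr [a Ia <-]; exists (r * a); rewrite 1?mulrCA //; apply: IM.
Qed.

Lemma is_ideal1 : is_ideal R [set` R].
Proof. by split=> //; apply: submodule_ring. Qed.

Lemma invertible_scale x I : invertible R I -> x != 0 ->
  scale_ideal x I `<=` [set` R] -> invertible R (scale_ideal x I).
Proof.
move=> [[hI _] [J [hJ _] IJ]] x0 xIR.
have xI : is_ideal R (scale_ideal x I) by split=> //; apply: scale_submodule.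
split; first by apply: ideal_fractional.
exists (scale_ideal x^-1 J); last first.
  rewrite mul_scale_ideal [mul_ideal I _]mul_idealC mul_scale_ideal.
  by rewrite mul_idealC IJ scale_idealM divff // scale_ideal1.
split; first exact: scale_submodule.
have [a Ia a0] : exists2 a, I a & a != 0.
  apply: contrapT => na.
  have : mul_ideal I J `<=` [set 0].
    apply: mul_ideal_ind => [//|_ _ -> ->|a b Ia Jb] /=; first by rewrite addr0.
    suff -> : a = 0 by rewrite mul0r.
    by apply/eqP/negPn/negP => a0; apply: na; exists a.
  rewrite IJ => /(_ 1) /=; rewrite rpred1 => /(_ isT) /eqP.
  by rewrite oner_eq0.
(* For b in J, (x a) (x^-1 b) = a b lies in I J = R, so x a is a denominator of x^-1 J. *)
exists (x * a); rewrite mulf_neq0 //; split=> //; first by apply: xIR; exists a.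
move=> _ [b Jb <-]; rewrite mulrACA divff // mul1r.
have : mul_ideal I J (a * b) by apply: mul_idealP.
by rewrite IJ.
Qed.

Lemma invertible_prin x : x \in R -> x != 0 -> invertible R (prin_ideal R x).
Proof.
move=> Rx x0; rewrite prin_idealE.
apply: invertible_scale => //; first exact: invertible1.
by move=> _ [a Ra <-] /=; rewrite rpredM.
Qed.

Lemma mul_invertibleW I J : fractional R I -> fractional R J ->
  invertible R (mul_ideal I J) -> invertible R I.
Proof.
move=> fI fJ [_ [L fL IJL]]; split=> //.
by exists (mul_ideal J L); [apply: fractionalM|rewrite mul_idealA].
Qed.

Lemma pic_classE I (hI : invertible R I) :
  pic_class R I = \pi_(Pic R) (InvIdeal hI).
Proof.
rewrite /pic_class; case: pselect => // h.
by congr (\pi_(Pic R) _); apply: inv_ideal_inj.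
Qed.

Lemma pic_classM I J : invertible R I -> invertible R J ->
  pic_class R (mul_ideal I J) = pic_class R I + pic_class R J.
Proof.
move=> hI hJ; rewrite (pic_classE hI) (pic_classE hJ).
rewrite (pic_classE (invertibleM hI hJ)).
by rewrite -raddfD; congr (\pi_(Pic R) _); apply: inv_ideal_inj.
Qed.

Lemma pic_class1 : pic_class R [set` R] = 0.
Proof.
apply: (addrI (pic_class R [set` R])); rewrite addr0.
rewrite -pic_classM ?mul_ideal1l //; try exact: invertible1.
exact: submodule_ring.
Qed.

(** Equality of classes says that I J^-1 is some (x); multiplying by J, or by its inverse, passes
    between this and I = x J. *)
Lemma pic_class_eqP I J : invertible R I -> invertible R J ->
  pic_class R I = pic_class R J <-> ideal_sim J I.
Proof.
move=> hI hJ; rewrite (pic_classE hI) (pic_classE hJ).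
pose I' := InvIdeal hI; pose J' := InvIdeal hJ.
have piE : (\pi_(Pic R) I' = \pi_(Pic R) J') <->
    exists2 x, x != 0 & I' - J' = prin_ideal R x :> set K.
  split=> [/eqP|E]; first by rewrite -Quotient.idealrBE => /asboolP.
  by apply/eqP; rewrite -Quotient.idealrBE; apply/asboolP.
rewrite piE.
have hsub L : invertible R L -> submodule R L by case=> -[].
have IJ : mul_ideal (I' - J')%R J = I.
  by have /(congr1 (@inv_ideal_set _ _)) := subrK J' I'.
split=> -[x x0 E]; exists x => //.
  by rewrite -IJ E prin_idealE mul_scale_ideal mul_ideal1l //; apply: hsub.
have -> : I' - J' = prin_ideal R x :> set K; last by [].
have [J'' _ JJ] := hJ.2.
rewrite -[LHS](@mul_ideal1r _ R); last exact: hsub (inv_idealP _).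
by rewrite -JJ mul_idealA IJ -E mul_scale_ideal JJ prin_idealE.
Qed.

End PicardClasses.

(** * Divisors of products of primes *)

Section IdealProducts.
Variables (K : fieldType) (R : subringClosed K).
Implicit Types (I J C D P : set K) (x y : K) (s t : seq (set K)).
Local Notation prodi s := (\big[@mul_ideal K/[set` R]]_(P <- s) P).

Lemma mul_is_ideal I J :
  is_ideal R I -> is_ideal R J -> is_ideal R (mul_ideal I J).
Proof.
move=> hI hJ; split; last by apply: submodule_mul; case: hI.
by move=> x /(mul_ideal_sub hI hJ.2) /hJ.1.
Qed.

Lemma prod_is_ideal s :
  (forall P, P \in s -> is_ideal R P) -> is_ideal R (prodi s).
Proof.
move=> hs; rewrite big_seq; elim/big_ind: _ => //; first exact: is_ideal1.
by move=> I J; apply: mul_is_ideal.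
Qed.

Lemma prod_ideal_cat s t : (forall P, P \in t -> is_ideal R P) ->
  prodi (s ++ t) = mul_ideal (prodi s) (prodi t).
Proof.
move=> ht; elim: s => [|P s IHs].
  by rewrite big_nil mul_ideal1l //; case: (prod_is_ideal ht).
by rewrite cat_cons !big_cons IHs mul_idealA.
Qed.

Lemma prod_ideal_prinX s x k : (forall P, P \in s -> is_ideal R P) ->
  prodi s = prin_ideal R x ->
  prodi (flatten (nseq k s)) = prin_ideal R (x ^+ k).
Proof.
move=> hs sx; elim: k => [|k IHk].
  by rewrite big_nil prin_idealE scale_ideal1.
rewrite /= prod_ideal_cat ?IHk ?sx.
  rewrite !prin_idealE mul_scale_ideal mul_ideal1l ?scale_idealM ?exprS //.
  exact/scale_submodule/submodule_ring.
by move=> P /flattenP[t /nseqP[-> _]]; apply: hs.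
Qed.

Lemma prod_invertible s : (forall P, P \in s -> is_ideal R P) ->
  invertible R (prodi s) -> forall P, P \in s -> invertible R P.
Proof.
elim: s => // P s IHs hs; rewrite big_cons => inv Q.
have hP : is_ideal R P by apply: hs; apply: mem_head.
have hs' L : L \in s -> is_ideal R L.
  by move=> sL; apply: hs; rewrite inE sL orbT.
have fP := ideal_fractional hP; have fs := ideal_fractional (prod_is_ideal hs').
rewrite inE => /predU1P[->|]; first exact: mul_invertibleW inv.
apply: IHs => //; apply: mul_invertibleW fs fP _.
by rewrite mul_idealC.
Qed.

Lemma prime_ideal_mul P C D : prime_ideal R P -> C `<=` [set` R] ->
  D `<=` [set` R] -> mul_ideal C D `<=` P -> C `<=` P \/ D `<=` P.
Proof.
move=> [hP _ pP] CR DR CDP.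
have [CP|nCP] := pselect (C `<=` P); [by left|right=> d Dd].
have [c Cc nPc] : exists2 c, C c & ~ P c.
  apply: contrapT => nc; apply: nCP => c Cc.
  by apply: contrapT => nPc; apply: nc; exists c.
by have [] := pP c d (CR _ Cc) (DR _ Dd) (CDP _ (mul_idealP Cc Dd)).
Qed.

(** The first prime P of the list contains C D, hence contains C or D, and is cancelled from that
    factor. Cancelling it from C changes the class by [P], which is in H. When the list is
    exhausted, C D = R forces C = R. *)
Lemma pic_class_divisor s (H : {pred Pic R}) C D : zmod_closed H ->
    (forall P, P \in s ->
      [/\ prime_ideal R P, invertible R P & pic_class R P \in H]) ->
    invertible R C -> is_ideal R C -> is_ideal R D ->
  mul_ideal C D = prodi s -> pic_class R C \in H.
Proof.
move=> [H0 HB]; elim: s C D => [|P s IHs] C D hs iC hC hD.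
  rewrite big_nil => CD; have -> : C = [set` R].
    apply: (ideal1 hC); apply: (mul_ideal_sub hD hC.2).
    by rewrite mul_idealC CD /= rpred1.
  by rewrite pic_class1.
have [pP iP HP] := hs P (mem_head _ _).
have hs' Q : Q \in s ->
    [/\ prime_ideal R Q, invertible R Q & pic_class R Q \in H].
  by move=> sQ; apply: hs; rewrite inE sQ orbT.
have hP : is_ideal R P by case: pP.
have his : is_ideal R (prodi s).
  by apply: prod_is_ideal => Q /hs'[[]].
rewrite big_cons => CD.
have [J iJ JP] := invertibleV iP.
have quot E : is_ideal R E -> E `<=` P -> is_ideal R (mul_ideal J E).
  move=> hE EP; split; last first.
    by rewrite mul_idealC; apply: submodule_mul; case: hE.
  rewrite -JP; apply: mul_ideal_ind => [|a b|a b Ja Eb].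
  - exact: mul_ideal0.
  - exact: mul_idealD.
  - by apply: mul_idealP => //; apply: EP.
have JCD : mul_ideal J (mul_ideal C D) = prodi s.
  by rewrite CD mul_idealA JP mul_ideal1l //; case: his.
have : mul_ideal C D `<=` P.
  by rewrite CD mul_idealC; apply: (mul_ideal_sub his hP.2).
case/(prime_ideal_mul pP hC.1 hD.1) => [CP|DP]; last first.
  apply: (IHs C (mul_ideal J D)) => //; [exact: quot|].
  by rewrite mul_idealA (mul_idealC C) -mul_idealA.
have HC : pic_class R (mul_ideal J C) \in H.
  apply: (IHs _ D) => //; [exact: invertibleM|exact: quot|].
  by rewrite -mul_idealA.
have -> : C = mul_ideal P (mul_ideal J C).
  by rewrite mul_idealA (mul_idealC P) JP mul_ideal1l //; case: hC.
rewrite pic_classM //; last exact: invertibleM.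
rewrite -[X in _ + X]opprK; apply: (HB) => //.
by rewrite -[- _]sub0r; apply: (HB).
Qed.

(** The integral ideals y A B^-1 and x B A^-1 have product (lam^k), which is [s] repeated k times,
    so the class [A] - [B] of the first falls under [pic_class_divisor]. The factorization [s] of
    (lam) is a hypothesis, so that the lemma serves both Z[lam] and O_K. *)
Lemma colon_eq_mod s lam A B x y k : (forall P, P \in s -> prime_ideal R P) ->
    prodi s = prin_ideal R lam -> lam \in R -> lam != 0 ->
    is_ideal R A -> is_ideal R B -> invertible R A -> invertible R B ->
    colon A B x -> colon B A y -> x * y = lam ^+ k ->
  eq_mod [set pic_class R P | P in prime_divisors R (prin_ideal R lam)]
    (pic_class R A) (pic_class R B).
Proof.
move=> ps sE Rlam lam0 hA hB iA iB xB yA xy H hH subH.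
have hs P : P \in s -> is_ideal R P by move=> /ps[].
have isP P : P \in s -> invertible R P.
  by apply: prod_invertible => //; rewrite sE; apply: invertible_prin.
have Hs P : P \in s -> pic_class R P \in H.
  by move=> sP; apply: subH; exists P => //; exists s.
have [A' iA' AA'] := invertibleV iA; have [B' iB' BB'] := invertibleV iB.
have : x * y != 0 by rewrite xy expf_neq0.
rewrite mulf_eq0 negb_or => /andP[x0 y0].
have yAB : scale_ideal y A `<=` B by move=> _ [a Aa <-]; apply: yA.
have xBA : scale_ideal x B `<=` A by move=> _ [b Bb <-]; apply: xB.
have mulV I J L : is_ideal R I -> mul_ideal L J = [set` R] -> I `<=` J ->
    is_ideal R (mul_ideal I L).
  move=> hI LJ IJ; split; last by apply: submodule_mul; case: hI.
  rewrite -LJ mul_idealC; apply: mul_ideal_ind => [|a b|a b La Ib].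
  - exact: mul_ideal0.
  - exact: mul_idealD.
  - by apply: mul_idealP => //; apply: IJ.
have hyA : is_ideal R (scale_ideal y A).
  by split; [move=> a /yAB /hB.1|apply: scale_submodule; case: hA].
have hxB : is_ideal R (scale_ideal x B).
  by split; [move=> a /xBA /hA.1|apply: scale_submodule; case: hB].
have iyA : invertible R (scale_ideal y A).
  by apply: invertible_scale => // a /yAB /hB.1.
have CE : pic_class R (mul_ideal (scale_ideal y A) B') =
    pic_class R A - pic_class R B.
  rewrite pic_classM //.
  have -> : pic_class R (scale_ideal y A) = pic_class R A.
    by apply/pic_class_eqP => //; exists y.
  by congr (_ + _); apply/eqP; rewrite -addr_eq0 -pic_classM // BB' pic_class1.
rewrite -CE.
apply: (@pic_class_divisor (flatten (nseq k s)) _ _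
  (mul_ideal (scale_ideal x B) A')).
- exact: hH.
- by move=> P /flattenP[t /nseqP[-> _]] Ps; split;
    [apply: ps|apply: isP|apply: Hs].
- exact: invertibleM.
- exact: mulV BB' yAB.
- exact: mulV AA' xBA.
rewrite (@prod_ideal_prinX _ lam) // !mul_scale_ideal.
rewrite (mul_idealC _ (scale_ideal x _)) mul_scale_ideal scale_idealM mulrC xy.
rewrite prin_idealE; congr scale_ideal.
rewrite mul_idealA -(mul_idealA B) AA' (mul_ideal1r hB.2) mul_idealC BB' //.
Qed.

End IdealProducts.

(** * Inverting lam *)

Section Localization.
Variables (K : fieldType) (R S : subringClosed K) (lam : K).
Hypotheses (RS : {subset R <= S}) (Rlam : lam \in R) (Slam : lam^-1 \in S)
  (lam0 : lam != 0).

Lemma submodule_overring : submodule R [set` S].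
Proof.
split=> [|a b Sa Sb|r a Rr Sa] /=; first exact: rpred0.
  exact: rpredD.
by apply: rpredM => //; apply: RS.
Qed.

(** A factor of the invertible ideal (lam) is invertible, and it contains the whole product, in
    particular lam. *)
Lemma prime_divisor_ideal P : prime_divisors R (prin_ideal R lam) P ->
  [/\ is_ideal R P, invertible R P & P lam].
Proof.
move=> [s [ps sE sP]].
have hs Q : Q \in s -> is_ideal R Q by move=> /ps[].
split; first exact: hs.
  by apply: prod_invertible sP => //; rewrite sE; apply: invertible_prin.
have : prin_ideal R lam lam by exists 1; rewrite ?mul1r //=; apply: rpred1.
rewrite -sE; move: lam; elim: s sP hs {ps sE} => // Q s IHs sP hs x.
have hQ : is_ideal R Q by apply: hs; apply: mem_head.
have hs' L : L \in s -> is_ideal R L.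
  by move=> sL; apply: hs; rewrite inE sL orbT.
rewrite big_cons; move: sP; rewrite inE => /predU1P[->|sP].
  by rewrite mul_idealC; apply: (mul_ideal_sub (prod_is_ideal hs') hQ.2).
by move/(mul_ideal_sub hQ (prod_is_ideal hs').2); apply: IHs.
Qed.

Lemma eq_mod_extension A B : invertible R A -> invertible R B ->
  eq_mod [set pic_class R P | P in prime_divisors R (prin_ideal R lam)]
    (pic_class R A) (pic_class R B) ->
  ideal_sim (mul_ideal [set` S] A) (mul_ideal [set` S] B).
Proof.
move=> iA iB.
(* The classes of ideals that become principal in S; once H is a subgroup containing the [P_i], it
   contains [A] - [B]. *)
pose H : {pred Pic R} := [pred c | `[< exists I, [/\ invertible R I,
  pic_class R I = c & ideal_sim [set` S] (mul_ideal [set` S] I)] >]].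
have HB : zmod_closed H.
  split=> [|_ _ /asboolP[I [iI <- [x x0 xE]]] /asboolP[J [iJ <- [y y0 yE]]]];
    apply/asboolP.
    exists [set` R]; split; rewrite ?pic_class1 //; first exact: invertible1.
    exists 1; rewrite ?oner_neq0 // scale_ideal1.
    by rewrite (mul_ideal1r submodule_overring).
  have [J' iJ' JJ] := invertibleV iJ.
  exists (mul_ideal I J'); split; first exact: invertibleM.
    rewrite pic_classM //; congr (_ + _).
    by apply/eqP; rewrite -addr_eq0 -pic_classM // JJ pic_class1.
  exists (x * y^-1); first by rewrite mulf_neq0 ?invr_neq0.
  rewrite -scale_idealM.
  have -> : scale_ideal y^-1 [set` S] = mul_ideal [set` S] J'.
    rewrite -[in LHS](mul_ideal1r submodule_overring) -JJ (mul_idealC J').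
    rewrite mul_idealA -yE mul_scale_ideal scale_idealM mulVf //.
    by rewrite scale_ideal1.
  by rewrite -mul_scale_ideal xE mul_idealA.
move=> /(_ H HB) ABH.
have {ABH} /asboolP[I [iI IE [x x0 xE]]] : pic_class R A - pic_class R B \in H.
  apply: ABH => _ [P pP <-] /=.
  have [[PR hP] iP Plam] := prime_divisor_ideal pP.
  apply/asboolP; exists P; split=> //; exists 1; rewrite ?oner_neq0 //.
  (* P contains lam, a unit of S, so P generates the unit ideal of S. *)
  rewrite scale_ideal1; apply/esym/ideal1.
    by apply: ideal_extension => a /PR /RS.
  by rewrite -(mulVf lam0); apply: mul_idealP.
have : pic_class R A = pic_class R (mul_ideal I B).
  by rewrite pic_classM // IE subrK.
move=> /(pic_class_eqP iA (invertibleM iI iB))[y y0 yE].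
(* A = y I B and S I = x S give S A = y x S B. *)
exists (y * x)^-1; first by rewrite invr_neq0 // mulf_neq0.
rewrite -yE (mul_idealC _ (scale_ideal y _)) mul_scale_ideal.
rewrite (mul_idealC _ [set` S]) mul_idealA -xE mul_scale_ideal !scale_idealM.
rewrite -mulrA mulVf ?mulf_neq0 //.
by rewrite scale_ideal1.
Qed.

End Localization.

(** * Denominators in Z[1/lam] *)

Section Zadjoin.
Variable K : fieldExtType rat.
Implicit Types (lam x : K) (A B : set K).

Lemma horner_map_intr (p : {poly int}) x :
  (map_poly intr p).[x] = \sum_(i < size p) (p`_i)%:~R * x ^+ i.
Proof. exact: horner_poly. Qed.

Lemma mem_Zadjoin lam : lam \in Zadjoin lam.
Proof. by apply/asboolP; exists 'X; rewrite map_polyX hornerX. Qed.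

Lemma Zadjoin_sub lam (R : subringClosed K) :
  lam \in R -> {subset Zadjoin lam <= R}.
Proof. by move=> Rlam _ /asboolP[p ->]; apply: horner_intr_in. Qed.

(** Dividing a monic integral equation of lam, of degree n + 1, by lam^n expresses lam as an integer
    polynomial in 1/lam. *)
Lemma integer_in_ZadjoinV lam :
  lam \in integers K -> lam != 0 -> lam \in Zadjoin lam^-1.
Proof.
move=> /asboolP[p pm /rootP p0] lam0.
have p1 : (1 < size p)%N.
  rewrite ltnNge; apply/negP => /size1_polyC pC.
  move: pm p0; rewrite pC monicE lead_coefC => /eqP->.
  by rewrite map_polyC /= hornerC => /eqP; rewrite oner_eq0.
have [n nE] : exists n, size p = n.+2.
  by exists (size p).-2; case: (size p) p1 => [|[|]].
have : \sum_(i < n.+2) (p`_i)%:~R * lam ^+ i = 0.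
  by rewrite -nE -horner_map_intr.
rewrite big_ord_recr /=.
have -> : p`_n.+1 = 1 by move: pm; rewrite monicE lead_coefE nE => /eqP.
rewrite mul1r => /eqP; rewrite addrC addr_eq0 => /eqP E.
suff : lam ^+ n.+1 * lam ^- n \in Zadjoin lam^-1.
  by rewrite exprS mulfK // expf_neq0.
rewrite E mulNr rpredN mulr_suml rpred_sum // => i _.
rewrite -mulrA rpredM ?rpred_int //.
have -> : lam ^+ i * lam ^- n = lam^-1 ^+ (n - i).
  have le_in : (i <= n)%N by rewrite -ltnS.
  by rewrite exprVn expfB_cond ?invf_div // (negPf lam0).
by apply: rpredX; apply: mem_Zadjoin.
Qed.

Lemma ZadjoinV_denom lam x : lam != 0 -> x \in Zadjoin lam^-1 ->
  exists k, lam ^+ k * x \in Zadjoin lam.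
Proof.
move=> lam0 /asboolP[p ->]; exists (size p).
rewrite horner_map_intr mulr_sumr rpred_sum // => i _.
rewrite mulrCA rpredM ?rpred_int //.
have -> : lam ^+ size p * lam^-1 ^+ i = lam ^+ (size p - i).
  by rewrite expfB_cond ?(negPf lam0) ?(ltnW (ltn_ord i)) // exprVn.
by rewrite rpredX // mem_Zadjoin.
Qed.

Lemma extension_denom lam A x : lam != 0 -> submodule (Zadjoin lam) A ->
  mul_ideal [set` Zadjoin lam^-1] A x -> exists k, A (lam ^+ k * x).
Proof.
move=> lam0 [A0 AD AM].
have AX k a : A a -> A (lam ^+ k * a).
  by apply: AM; rewrite rpredX // mem_Zadjoin.
move: x; apply: mul_ideal_ind => [|x y [k Ax] [l Ay]|x a /= Sx Aa].
- by exists 0%N; rewrite mulr0.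
- exists (k + l)%N; rewrite mulrDr; apply: AD.
    by rewrite addnC exprD -mulrA; apply: AX.
  by rewrite exprD -mulrA; apply: AX.
- have [k kx] := ZadjoinV_denom lam0 Sx.
  by exists k; rewrite mulrA; apply: AM.
Qed.

(** A nonzero A contains some N > 0 and is generated by N and the finitely many representatives of A
    / N A: an element r + N h has h in A, hence in Z[lam]. One power of lam therefore clears all
    denominators. *)
Lemma colon_denom lam A B x : lam \in integers K -> lam != 0 ->
    is_ideal (Zadjoin lam) A -> is_ideal (Zadjoin lam) B ->
    scale_ideal x (mul_ideal [set` Zadjoin lam^-1] A) `<=`
      mul_ideal [set` Zadjoin lam^-1] B ->
  exists k, colon B A (lam ^+ k * x).
Proof.
move=> lamO lam0 hA hB xAB; have [AR subA] := hA; have [_ [B0 BD BM]] := hB.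
have BX k b : B b -> B (lam ^+ k * b).
  by apply: BM; rewrite rpredX // mem_Zadjoin.
have xB a : A a -> exists k, B (lam ^+ k * (x * a)).
  move=> Aa; apply: (extension_denom lam0 hB.2).
  by apply: xAB; exists a => //; apply: sub_extension.
have xBs (s : seq K) : (forall a, a \in s -> A a) ->
    exists k, forall a, a \in s -> B (lam ^+ k * (x * a)).
  elim: s => [|a s IHs] sA; first by exists 0%N.
  have [b sb|k ks] := IHs; first by apply: sA; rewrite inE sb orbT.
  have [l la] := xB a (sA a (mem_head _ _)).
  exists (k + l)%N => b /[!inE] /predU1P[->|/ks kb].
    by rewrite exprD -mulrA; apply: BX.
  by rewrite addnC exprD -mulrA; apply: BX.
have [A_0|A_nz] := pselect (A = [set 0]).
  by exists 0%N => a; rewrite A_0 => /= ->; rewrite mulr0.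
have [a Aa a0] := ideal_neq0 subA A_nz.
have RO := Zadjoin_sub lamO.
have [N N0 AN] := ideal_nat RO hA Aa a0.
have [s sA sP] := finite_mod_gt0 (submodule_subgroup subA) N0.
have [|k ks] := xBs (N%:R :: s); first by move=> b /[!inE] /predU1P[->|/sA].
exists k => b /sP[r rs [h /AR Rh ->]].
rewrite -(mulr_natl h) -mulrA !mulrDr; apply: BD.
  by apply: ks; rewrite inE rs orbT.
have -> : lam ^+ k * (x * (N%:R * h)) = h * (lam ^+ k * (x * N%:R)) by ring.
by apply: BM => //; apply: ks; apply: mem_head.
Qed.

(** Powers of lam move xi and 1/xi into the two colons. Conversely, x y = lam^k is a unit of
    Z[1/lam], so y^-1 = lam^-k x carries the extension of B back into that of A. *)
Lemma ideal_sim_extensionP lam A B : lam \in integers K -> lam != 0 ->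
    is_ideal (Zadjoin lam) A -> is_ideal (Zadjoin lam) B ->
  ideal_sim (mul_ideal [set` Zadjoin lam^-1] A)
    (mul_ideal [set` Zadjoin lam^-1] B) <->
  exists x y k, [/\ colon A B x, colon B A y & x * y = lam ^+ k].
Proof.
move=> lamO lam0 hA hB; set S := [set` _]; split.
  move=> [x x0 xAB].
  have [k kx] : exists k, colon B A (lam ^+ k * x).
    by apply: colon_denom => //; rewrite xAB.
  have [l lx] : exists l, colon A B (lam ^+ l * x^-1).
    apply: colon_denom => //; rewrite -/S -xAB scale_idealM mulVf //.
    by rewrite scale_ideal1.
  exists (lam ^+ l * x^-1), (lam ^+ k * x), (l + k)%N; split=> //.
  by rewrite exprD mulrACA mulVf // mulr1.
move=> [x [y [k [xBA yAB xy]]]].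
have ext C D z : colon C D z ->
    forall a, mul_ideal S D a -> mul_ideal S C (z * a).
  move=> zDC; apply: mul_ideal_ind => [|a b ? ?|r d Sr Dd] /=.
  - by rewrite mulr0; apply: mul_ideal0.
  - by rewrite mulrDr; apply: mul_idealD.
  - by rewrite mulrCA; apply: mul_idealP => //; apply: zDC.
have : x * y != 0 by rewrite xy expf_neq0.
rewrite mulf_eq0 negb_or => /andP[x0 y0].
exists y => //; apply/seteqP; split=> [_ [a Aa <-]|b Bb]; first exact: ext Aa.
exists (y^-1 * b); last by rewrite mulVKf.
have -> : y^-1 * b = lam^-1 ^+ k * (x * b).
  by rewrite exprVn -xy invfM mulrACA mulVf // mul1r.
have [_ _ AM] : submodule (Zadjoin lam^-1) (mul_ideal S A).
  by apply: submodule_mul; apply: submodule_ring.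
by apply: AM; [rewrite rpredX // mem_Zadjoin|apply: ext Bb].
Qed.

End Zadjoin.

(** * Factorization of (lam) in Z[lam] and O_K, and the three assertions *)

Lemma prin_ideal_factorization (K : fieldExtType rat) (R : subringClosed K)
    (lam : K) : {subset R <= integers K} -> lam \in R -> lam != 0 ->
    prime_to_conductor R (prin_ideal R lam) ->
  exists2 s : seq (set K), forall Q, Q \in s -> prime_ideal R Q &
    \big[@mul_ideal K/[set` R]]_(Q <- s) Q = prin_ideal R lam.
Proof.
move=> RO Rlam lam0 fl.
have hl : is_ideal R (prin_ideal R lam).
  split; last by rewrite prin_idealE; apply/scale_submodule/submodule_ring.
  by move=> _ [r Rr <-] /=; rewrite rpredM.
have ll : prin_ideal R lam lam by exists 1; rewrite ?mul1r //=; apply: rpred1.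
have [N N0 lN] := ideal_nat RO hl ll lam0.
exact: prime_factorization RO N0 hl lN fl.
Qed.

(** The conductor of O_K in itself is O_K, so the witness 0 works; the factorization of (lam) thus
    applies to O_K unconditionally. *)
Lemma prime_to_conductor_integers (K : fieldExtType rat) (C : set K) :
  is_ideal (integers K) C -> prime_to_conductor (integers K) C.
Proof.
move=> hC; apply/prime_to_conductorE => //; exists 0; first by case: hC.2.
by rewrite subr0; split=> [|b]; rewrite ?rpred1 // mul1r.
Qed.

Theorem theorem1 (K : fieldExtType rat) (lam : K)
    (lam_int : lam \in integers K) (lam_neq0 : lam != 0)
    (K_gen : <<1%VS; lam>>%VS = fullv)
    (fA fB A B : set K)
    (fA_ideal : is_ideal (Zadjoin lam^-1) fA)
    (fB_ideal : is_ideal (Zadjoin lam^-1) fB)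
    (A_ideal : is_ideal (Zadjoin lam) A)
    (B_ideal : is_ideal (Zadjoin lam) B)
    (fAE : fA = mul_ideal [set` Zadjoin lam^-1] A)
    (fBE : fB = mul_ideal [set` Zadjoin lam^-1] B) :
  [/\ ideal_sim fA fB <->
      (exists x y (k : nat), [/\ colon A B x, colon B A y & x * y = lam ^+ k]),

      A <> [set 0] -> B <> [set 0] ->
      prime_to_conductor (Zadjoin lam) A ->
      prime_to_conductor (Zadjoin lam) B ->
      prime_to_conductor (Zadjoin lam) (prin_ideal (Zadjoin lam) lam) ->
      (ideal_sim fA fB <->
       eq_mod [set pic_class (Zadjoin lam) P |
                P in prime_divisors (Zadjoin lam)
                       (prin_ideal (Zadjoin lam) lam)]
         (pic_class (Zadjoin lam) A) (pic_class (Zadjoin lam) B))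

    & A <> [set 0] -> B <> [set 0] ->
      ideal_sim fA fB ->
      eq_mod [set cl_class Q |
               Q in prime_divisors (integers K) (prin_ideal (integers K) lam)]
        (cl_class (mul_ideal [set` integers K] A))
        (cl_class (mul_ideal [set` integers K] B))].
Proof.
have lamR := mem_Zadjoin lam.
have RO := Zadjoin_sub lam_int.
have RS := Zadjoin_sub (integer_in_ZadjoinV lam_int lam_neq0).
have simP := ideal_sim_extensionP lam_int lam_neq0 A_ideal B_ideal.
rewrite fAE fBE; split=> [//|A_nz B_nz fA_ fB_ fl|A_nz B_nz /simP].
  have iA := coprime_invertible RO A_ideal A_nz fA_.
  have iB := coprime_invertible RO B_ideal B_nz fB_.
  split=> [/simP[x [y [k [xBA yAB xy]]]]|].
    have [s ps sE] := prin_ideal_factorization RO lamR lam_neq0 fl.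
    exact: colon_eq_mod ps sE lamR lam_neq0 A_ideal B_ideal iA iB xBA yAB xy.
  exact: (eq_mod_extension RS lamR (mem_Zadjoin _) lam_neq0 iA iB).
(* For (iii), the pair x, y from (i) stays in the colons of the ideals extended to O_K, where
   nonzero ideals are invertible, and the argument of (ii) is run over O_K. *)
move=> [x [y [k [xBA yAB xy]]]].
set O := integers K.
have hO C : is_ideal (Zadjoin lam) C -> is_ideal O (mul_ideal [set` O] C).
  by move=> [CR _]; apply: ideal_extension => c /CR /RO.
have iO C : is_ideal (Zadjoin lam) C -> C <> [set 0] ->
    invertible O (mul_ideal [set` O] C).
  move=> hC C_nz; apply: integers_ideal_invertible; first exact: hO.
  have [c Cc c0] := ideal_neq0 hC.2 C_nz.
  move=> OC; have : mul_ideal [set` O] C c by apply: sub_extension.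
  by rewrite OC => /eqP; apply/negP.
have ext C D z : colon C D z ->
    colon (mul_ideal [set` O] C) (mul_ideal [set` O] D) z.
  move=> zDC; apply: mul_ideal_ind => [|a b ? ?|r d Or Dd] /=.
  - by rewrite mulr0; apply: mul_ideal0.
  - by rewrite mulrDr; apply: mul_idealD.
  - by rewrite mulrCA; apply: mul_idealP => //; apply: zDC.
have [|s ps sE] := prin_ideal_factorization (fun _ => id) lam_int lam_neq0.
  apply: prime_to_conductor_integers; split; last first.
    by rewrite prin_idealE; apply/scale_submodule/submodule_ring.
  by move=> _ [r Or <-] /=; rewrite rpredM.
exact: colon_eq_mod ps sE lam_int lam_neq0 (hO _ A_ideal) (hO _ B_ideal)
  (iO _ A_ideal A_nz) (iO _ B_ideal B_nz) (ext _ _ _ xBA) (ext _ _ _ yAB) xy.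
Qed.
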